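(* Consider the two-party nonsignaling scenario with cardinalities $\overline{C}=(3,3,3)$ (three inputs, three outputs each) and $\overline{D}=(2,2)$ (two inputs, two outputs each). The images $(\Lambda\otimes\mathrm{id}_{\mathcal D})\vec P^{\mathrm{PR}}$ of the PR box $\vec P^{\mathrm{PR}}\in\mathcal{A}\otimes\mathcal{D}$, $\overline{A}=(2,2)$, under all left invertible deterministic local maps $\Lambda:\mathcal{A}\to\mathcal{C}$ form a set of $1944$ distinct behaviors, all of which are extremal points of the nonsignaling polytope of the scenario $(\overline{C},\overline{D})$. Together with the $3^3\cdot2^2=108$ deterministic nonsignaling boxes, they form exactly the set of all $2052$ vertices of that nonsignaling polytope; that is, every extremal nonsignaling box of this scenario is either deterministic (local) or a lifting of the PR box.
   Context: A cardinality $\overline{A}=(A_1,\dots,A_X)$ is a finite sequence of positive integers: a device has $X$ inputs and, for its $x$-th input, $A_x$ outputs. The associated space is $\mathcal{A}=\mathbb{R}^{\sum_xA_x}$ with coordinates indexed by pairs $(a,x)$; elements of $\mathcal{A}\otimes\mathcal{D}$ have coordinates $P(ab|xy)$ where $a,x$ refer to the first device and $b,y$ to the second. The nonsignaling polytope of a two-party scenario is the set of $\vec P$ with $P(ab|xy)\ge0$, $\sum_{ab}P(ab|xy)=1$ for all $x,y$, $\sum_aP(ab|xy)$ independent of $x$, and $\sum_bP(ab|xy)$ independent of $y$. A deterministic nonsignaling box is $P(ab|xy)=P_1(a|x)P_2(b|y)$ with $P_1,P_2$ conditional probability distributions valued in $\{0,1\}$. The PR box, for two devices of cardinality $(2,2)$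 with inputs and outputs labeled in $\{0,1\}$, is $P^{\mathrm{PR}}(ab|xy)=\frac12$ if $a\oplus b=xy$ (addition mod 2) and $0$ otherwise. A deterministic local map $\Lambda:\mathcal{A}\to\mathcal{C}$ is determined by a mapping $\xi$ from the inputs $z$ of $\mathcal{C}$ to the inputs of $\mathcal{A}$ and, for each $z$, a mapping $\alpha_z$ from the outputs of $\mathcal{A}$ for input $\xi(z)$ to the outputs of $\mathcal{C}$ for input $z$; its matrix has entry $\Lambda_{(c,z),(a,x)}=1$ if $x=\xi(z)$ and $c=\alpha_z(a)$, and $0$ otherwise. It is left invertible if there is a deterministic local map $\Lambda':\mathcal{C}\to\mathcal{A}$ with $\Lambda'\circ\Lambda=\mathrm{id}_{\mathcal A}$. A lifting of the PR box here means its image under such a map applied to the first device. *)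

(* Defs.v *)
From HB Require Import structures.
From mathcomp Require Import all_boot all_order all_algebra.
From mathcomp Require Import boolp classical_sets functions cardinality reals.

Set Implicit Arguments.
Unset Strict Implicit.
Unset Printing Implicit Defensive.

Import Order.TTheory GRing.Theory Num.Theory.
Local Open Scope classical_set_scope.
Local Open Scope ring_scope.

(* A cardinality (A_1, ..., A_X) is the sequence [:: A_1; ...; A_X]; inputs and
   outputs are numbered from 0. Positivity of the entries is not imposed: the
   scenarios of interest use explicit positive sequences. *)
Definition cardinality := seq nat.

Definition input (A : cardinality) := 'I_(size A).

Definition output (A : cardinality) (x : input A) := 'I_(nth 0%N A x).

Definition coord_idx (A : cardinality) := {x : 'I_(size A) & 'I_(nth 0%N A x)}.

(* The coordinate (a, x). *)
Definition crd (A : cardinality) (x : input A) (a : output x) : coord_idx A :=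
  Tagged (fun x : 'I_(size A) => 'I_(nth 0%N A x)) a.

(* The space R^(\sum_x A_x); values are taken in R^o (convertible to R) so that
   the lmodType R structure of finite functions is inferred. *)
Definition dev_space (R : realType) (A : cardinality) := {ffun coord_idx A -> R^o}.

(* The tensor product of two spaces, in coordinates: P(ab|xy) is
   P (crd a, crd b) for a : output x and b : output y. *)
Definition box (R : realType) (A D : cardinality) :=
  {ffun coord_idx A * coord_idx D -> R^o}.

Definition nonsignaling (R : realType) (A D : cardinality) :
    set (box R A D) :=
  [set P : box R A D |
    [/\ forall (x : input A) (y : input D) (a : output x) (b : output y),
          0 <= P (crd a, crd b),
        forall (x : input A) (y : input D),
          \sum_(a : output x) \sum_(b : output y) P (crd a, crd b) = 1,
        forall (x x' : input A) (y : input D) (b : output y),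
          \sum_(a : output x) P (crd a, crd b)
            = \sum_(a : output x') P (crd a, crd b) &
        forall (y y' : input D) (x : input A) (a : output x),
          \sum_(b : output y) P (crd a, crd b)
            = \sum_(b : output y') P (crd a, crd b)]].

Definition extreme_points (R : realType) (V : lmodType R) (S : set V) : set V :=
  [set v | S v /\
    forall (t : R) (u w : V), 0 < t < 1 -> S u -> S w ->
      v = t *: u + (1 - t) *: w -> u = v /\ w = v].

Definition cond_distribution (R : realType) (A : cardinality) :
    set (dev_space R A) :=
  [set p : dev_space R A |
    (forall (x : input A) (a : output x), 0 <= p (crd a)) /\
    (forall x : input A, \sum_(a : output x) p (crd a) = 1)].

Definition deterministic_distribution (R : realType) (A : cardinality) :
    set (dev_space R A) :=
  [set p : dev_space R A | cond_distribution p /\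
    forall (x : input A) (a : output x), p (crd a) = 0 \/ p (crd a) = 1].

Definition deterministic_boxes (R : realType) (A D : cardinality) :
    set (box R A D) :=
  [set P : box R A D |
    exists (p1 : dev_space R A) (p2 : dev_space R D),
      [/\ deterministic_distribution p1, deterministic_distribution p2 &
        forall (x : input A) (y : input D) (a : output x) (b : output y),
          P (crd a, crd b) = p1 (crd a) * p2 (crd b)]].

(* Matrices indexed by arbitrary finite types, acting on column vectors. *)
Definition mulmv (R : realType) (I J : finType) (M : I -> J -> R)
    (v : {ffun J -> R^o}) : {ffun I -> R^o} :=
  [ffun i => \sum_j M i j * v j].

Definition idmat (R : realType) (I : finType) (i j : I) : R := (i == j)%:R.

(* The matrix of the tensor product of two linear maps. *)
Definition kron (R : realType) (I J K L : finType) (M : I -> J -> R)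
    (N : K -> L -> R) (i : I * K) (j : J * L) : R := M i.1 j.1 * N i.2 j.2.

(* The data (xi, alpha) of a deterministic local map from A to C. *)
Record local_map (A C : cardinality) := LocalMap {
  xi : input C -> input A;
  alpha : forall z : input C, output (xi z) -> output z
}.

(* The entry in row (c, z) = q and column (a, x) = p is 1 iff x = xi z and
   c = alpha z a; the existential avoids casting along x = xi z. *)
Definition map_matrix (R : realType) (A C : cardinality) (L : local_map A C)
    (q : coord_idx C) (p : coord_idx A) : R :=
  [exists a : output (xi L (tag q)),
     (p == crd a) && (tagged q == @alpha A C L (tag q) a)]%:R.

Definition left_invertible (R : realType) (A C : cardinality)
    (L : local_map A C) : Prop :=
  exists L' : local_map C A,
    cancel (mulmv (map_matrix R L)) (mulmv (map_matrix R L')).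

Definition PR_box (R : realType) : box R [:: 2; 2]%N [:: 2; 2]%N :=
  [ffun pq : coord_idx [:: 2; 2]%N * coord_idx [:: 2; 2]%N =>
    if (tagged pq.1 + tagged pq.2 == tag pq.1 * tag pq.2 %[mod 2])%N
    then 2^-1 else 0].

Definition PR_liftings (R : realType) (C : cardinality) :
    set (box R C [:: 2; 2]%N) :=
  [set mulmv (kron (map_matrix R L) (@idmat R (coord_idx [:: 2; 2]%N))) (PR_box R)
    | L in [set L : local_map [:: 2; 2]%N C | left_invertible R L]].

Arguments nonsignaling R A D : clear implicits.
Arguments deterministic_boxes R A D : clear implicits.
Arguments PR_liftings R C : clear implicits.

(* Main.v *)
Require Import Defs.
From mathcomp Require Import all_boot all_order all_algebra.
From mathcomp Require Import boolp classical_sets functions cardinality reals.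
From mathcomp Require Import finmap lra.

Set Implicit Arguments.
Unset Strict Implicit.
Unset Printing Implicit Defensive.

Import Order.TTheory GRing.Theory Num.Theory.

Local Open Scope classical_set_scope.
Local Open Scope card_scope.
Local Open Scope ring_scope.

(** A nonsignaling box is extremal iff it is the only nonsignaling box whose
    support is contained in its own. It therefore suffices to find, inside the
    support of every nonsignaling box [P], the support of a deterministic box or
    of a lifting of the PR box, and to check that these two kinds of supports
    determine their boxes.

    If some pair [(b, b')] of answers of the second device to its two inputs can,
    for every input [z] of the first device, occur together with a common answer
    to [z], then [P] supports a deterministic box. Otherwise all answers of the
    second device have positive probability, so at every [z] the pairs admitting
    a common answer contain [{(0, 0), (1, 1)}] or [{(0, 1), (1, 0)}]; this gives
    a PR-like strategy at [z] with [x = 0] or [x = 1] respectively. The inputs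
    [z] at which [(0, 1)], resp. [(0, 0)], admits no common answer force the two
    outputs to be distinct, once with [x = 0] and once with [x = 1], and this is
    left invertibility. *)

Lemma crdE (A : cardinality) (q : coord_idx A) : q = crd (tagged q).
Proof. by case: q. Qed.

Lemma crd_inj (A : cardinality) (x : input A) : injective (@crd A x).
Proof. by move=> a a' /eqP; rewrite -tag_eqE /tag_eq eqxx tagged_asE => /eqP. Qed.

Lemma eq_crd (A : cardinality) (x x' : input A) (a : output x) (a' : output x') :
  x = x' -> a = a' :> nat -> crd a = crd a'.
Proof. by move=> e; subst x' => /val_inj ->. Qed.

(** * Supports of nonsignaling boxes and extremality *)

Section Support.
Variables (R : realType) (A D : cardinality).
Implicit Types P Q : box R A D.

Definition sub_support Q P := forall q, P q = 0 -> Q q = 0.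

Lemma nonsignaling_ge0 P q : nonsignaling R A D P -> 0 <= P q.
Proof. by case: q => q1 q2 [P0 _ _ _]; rewrite (crdE q1) (crdE q2). Qed.

Lemma nonsignaling_le1 P q : nonsignaling R A D P -> P q <= 1.
Proof.
case: q => q1 q2 NP; have [P0 P1 _ _] := NP.
rewrite (crdE q1) (crdE q2) -(P1 (tag q1) (tag q2)).
rewrite (bigD1 (tagged q1)) //= (bigD1 (tagged q2)) //= -addrA lerDl.
by rewrite addr_ge0 // sumr_ge0 // => a _; rewrite ?sumr_ge0.
Qed.

(** [T] lies on the line from [Q] through [P], beyond [P], so that [P = e Q + (1 - e) T]. The
    equalities defining the polytope are affine and persist along this line; only positivity needs
    the bound on [e * Q q]. *)
Lemma nonsignaling_extrapolate (e : R) P Q (T : box R A D) :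
  e < 1 -> nonsignaling R A D P -> nonsignaling R A D Q ->
  (forall q, e * Q q <= P q) ->
  (forall q, T q = (1 - e)^-1 * (P q - e * Q q)) ->
  nonsignaling R A D T.
Proof.
move=> e1 [_ P1 PA PB] [_ Q1 QA QB] le E.
have e0 : 1 - e != 0 by rewrite gt_eqF // subr_gt0.
split.
- move=> x y a b; rewrite E mulr_ge0 ?subr_ge0 //.
  by rewrite invr_ge0 subr_ge0 ltW.
- move=> x y; under eq_bigr do under eq_bigr do rewrite E.
  under eq_bigr do rewrite -mulr_sumr sumrB -mulr_sumr.
  by rewrite -mulr_sumr sumrB -mulr_sumr P1 Q1 mulr1 mulVf.
- move=> x x' y b; under eq_bigr do rewrite E; under [RHS]eq_bigr do rewrite E.
  by rewrite -!mulr_sumr !sumrB -!mulr_sumr (PA x x') (QA x x').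
- move=> y y' x a; under eq_bigr do rewrite E; under [RHS]eq_bigr do rewrite E.
  by rewrite -!mulr_sumr !sumrB -!mulr_sumr (PB y y') (QB y y').
Qed.

(** The inclusion of supports lets the segment from [Q] to [P] be prolonged a little inside the
    polytope, so [P] is a proper convex combination involving [Q]. *)
Lemma extreme_sub_support P Q : extreme_points (nonsignaling R A D) P ->
  nonsignaling R A D Q -> sub_support Q P -> Q = P.
Proof.
move=> [NP eP] NQ QP.
(* The least nonzero entry of [P], capped at 1/2 to keep [e < 1]. As entries of [Q] are at most 1,
   [e * Q q <= P q] on the support of [P]. *)
pose e : R := \big[Order.min/2^-1]_(q | P q != 0) P q.
have e0 : 0 < e.
  rewrite /e; elim/big_ind: _ => [|x y x0 y0|q Pq]; first by rewrite invr_gt0.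
  - by rewrite lt_min x0.
  - by rewrite lt_def Pq nonsignaling_ge0.
have e2 : e <= 2^-1 by apply: bigmin_le_id.
have e1 : e < 1 by lra.
have le q : e * Q q <= P q.
  have [Pq|Pq] := eqVneq (P q) 0; first by rewrite QP ?Pq ?mulr0.
  apply: (@le_trans _ _ e); last exact: bigmin_le_cond.
  by rewrite ler_piMr ?(ltW e0) ?nonsignaling_le1.
have [] // := eP e Q [ffun q => (1 - e)^-1 * (P q - e * Q q)].
- by rewrite e0.
- by apply: (nonsignaling_extrapolate e1 NP NQ le) => q; rewrite ffunE.
- apply/ffunP => q; rewrite !ffunE.
  change (P q = e * Q q + (1 - e) * ((1 - e)^-1 * (P q - e * Q q))).
  have e0' : 1 - e != 0 by rewrite gt_eqF ?subr_gt0.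
  by rewrite mulrA mulfV // mul1r addrC subrK.
Qed.

(** In a proper convex combination of nonnegative boxes, a zero entry of [P] vanishes in both terms,
    so minimality of [P] applies to each of them. *)
Lemma sub_support_extreme P : nonsignaling R A D P ->
  (forall Q, nonsignaling R A D Q -> sub_support Q P -> Q = P) ->
  extreme_points (nonsignaling R A D) P.
Proof.
move=> NP minP; split=> // t u w /andP[t0 t1] Nu Nw /ffunP eP.
have S q : P q = 0 -> u q = 0 /\ w q = 0.
  have -> : P q = t * u q + (1 - t) * w q by rewrite eP !ffunE.
  move/eqP.
  have u0 := nonsignaling_ge0 q Nu; have w0 := nonsignaling_ge0 q Nw.
  have t1' : 0 < 1 - t by rewrite subr_gt0.
  rewrite paddr_eq0; [|exact: mulr_ge0 (ltW t0) u0|exact: mulr_ge0 (ltW t1') w0].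
  by rewrite !mulf_eq0 (gt_eqF t0) (gt_eqF t1') => /andP[/eqP-> /eqP->].
by split; apply: minP => // q /S[].
Qed.

End Support.

(** * Cardinalities of finite sets *)

Lemma card_setT_finType (T : finType) : [set: T] #= `I_#|T|.
Proof.
have -> : [set: T] = [set` [fset x in enum T]%fset].
  by apply/seteqP; split=> // x _; rewrite /= inE mem_enum.
by apply/card_eq_fsetP; rewrite card_fseq undup_id ?enum_uniq // -cardE.
Qed.

Lemma card_set_finType (T : finType) (X : {set T}) : [set` X] #= `I_#|X|.
Proof.
have -> : [set` X] = [set` [fset x in enum X]%fset].
  by apply/seteqP; split=> x /=; rewrite inE mem_enum.
by apply/card_eq_fsetP; rewrite card_fseq undup_id ?enum_uniq // -cardE.
Qed.

Lemma card_setU_disjoint (T : choiceType) (X Y : set T) m n :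
  X #= `I_m -> Y #= `I_n -> X `&` Y = set0 -> X `|` Y #= `I_(m + n).
Proof.
move=> Xm Yn XY0.
have fX : finite_set X by exists m.
have fY : finite_set Y by exists n.
have fXY : finite_set (X `|` Y) by rewrite finite_setU.
rewrite -(fset_setK fXY); apply/card_eq_fsetP.
by rewrite fset_setU // cardfsU -fset_setI // XY0 fset_set0 cardfs0 subn0
  (card_fset_set Xm) (card_fset_set Yn).
Qed.

(** * Deterministic boxes *)

Section Deterministic.
Variable R : realType.

Lemma sum_eq_op (T : finType) (t : T) : \sum_(a : T) (a == t)%:R = 1 :> R.
Proof. by rewrite (bigD1 t) //= eqxx big1 ?addr0 // => a /negPf->. Qed.

Lemma sum_eq_op_mul (T : finType) (t : T) (F : T -> R) :
  \sum_(a : T) (a == t)%:R * F a = F t.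
Proof.
by rewrite (bigD1 t) //= eqxx mul1r big1 ?addr0 // => a /negPf->; rewrite mul0r.
Qed.

Definition det_dist (A : cardinality) (f : forall x : input A, output x) :
    dev_space R A :=
  [ffun q => (tagged q == f (tag q))%:R].

Lemma deterministic_distributionP (A : cardinality) (p : dev_space R A) :
  deterministic_distribution p <->
  exists f : (forall x : input A, output x), p = det_dist f.
Proof.
split=> [[[p0 p1] p01]|[f ->]]; last first.
  split=> [|x a]; last by rewrite ffunE /=; case: (a == f x); [right|left].
  split=> [x a|x]; first by rewrite ffunE /= ler0n.
  by under eq_bigr do rewrite ffunE /=; exact: sum_eq_op.
have ex1 (x : input A) : exists a : output x, p (crd a) == 1.
  apply/existsP; apply: contraT; rewrite negb_exists => /forallP ne1.
  have /eqP := p1 x; rewrite big1 ?(eq_sym 0) ?oner_eq0 // => a _.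
  by case: (p01 x a) => // pa1; move: (ne1 a); rewrite pa1 eqxx.
exists (fun x => xchoose (ex1 x)); apply/ffunP => q; rewrite (crdE q) ffunE /=.
move: (tag q) (tagged q) => x a; have /eqP := xchooseP (ex1 x).
set a1 := xchoose _; move=> pa1; have [->//|aa1] := eqVneq a a1.
(* A second entry equal to 1 would push the sum above 1. *)
case: (p01 x a) => // pa; have := p1 x.
rewrite (bigD1 a1) //= (bigD1 a) //= pa1 pa addrA => /eqP.
rewrite gt_eqF // -addrA ltrDl; apply: ltr_pwDl => //.
exact: sumr_ge0.
Qed.

Variables A D : cardinality.

Definition det_box (f : forall x : input A, output x)
    (g : forall y : input D, output y) : box R A D :=
  [ffun q => (tagged q.1 == f (tag q.1))%:R * (tagged q.2 == g (tag q.2))%:R].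

Lemma deterministic_boxesP (P : box R A D) : deterministic_boxes R A D P <->
  exists (f : forall x : input A, output x) (g : forall y : input D, output y),
    P = det_box f g.
Proof.
split=> [[p1 [p2 [/deterministic_distributionP[f ->]]]]|[f [g ->]]].
  move=> /deterministic_distributionP[g ->] E; exists f, g.
  by apply/ffunP => -[q1 q2]; rewrite (crdE q1) (crdE q2) E !ffunE.
exists (det_dist f), (det_dist g).
split; [apply/deterministic_distributionP; by exists f|
        apply/deterministic_distributionP; by exists g|].
by move=> x y a b; rewrite !ffunE.
Qed.

Lemma det_box_nonsignaling f g : nonsignaling R A D (det_box f g).
Proof.
split=> [x y a b|x y|x x' y b|y y' x a].
- by rewrite ffunE mulr_ge0 ?ler0n.
- under eq_bigr do under eq_bigr do rewrite ffunE /=.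
  by under eq_bigr do rewrite -mulr_sumr sum_eq_op mulr1; rewrite sum_eq_op.
- under eq_bigr do rewrite ffunE /=; under [RHS]eq_bigr do rewrite ffunE /=.
  by rewrite !sum_eq_op_mul.
- under eq_bigr do rewrite ffunE /=; under [RHS]eq_bigr do rewrite ffunE /=.
  by rewrite -!mulr_sumr !sum_eq_op.
Qed.

(** For each pair of inputs the support is a single entry, which normalization forces to be 1. *)
Lemma det_box_extreme f g : extreme_points (nonsignaling R A D) (det_box f g).
Proof.
apply: sub_support_extreme => [|Q [_ Q1 _ _] QP]; first exact: det_box_nonsignaling.
have Q0 (x : input A) (y : input D) (a : output x) (b : output y) :
    ~~ ((a == f x) && (b == g y)) -> Q (crd a, crd b) = 0.
  move=> nfg; apply: QP; rewrite ffunE /=.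
  by move: nfg; case: (a == _); case: (b == _); rewrite // ?(mul0r, mulr0).
apply/ffunP => -[q1 q2]; rewrite (crdE q1) (crdE q2) ffunE /=.
move: (tag q1) (tagged q1) (tag q2) (tagged q2) => x a y b.
have [/andP[/eqP-> /eqP->]|nfg] := boolP ((a == f x) && (b == g y)); last first.
  rewrite Q0 //; move: nfg.
  by case: (a == _); case: (b == _); rewrite // ?(mul0r, mulr0).
have Qa a' : a' != f x -> \sum_(b' : output y) Q (crd a', crd b') = 0.
  by move=> /negPf fa; rewrite big1 // => b' _; rewrite Q0 // fa.
rewrite !eqxx mulr1 -(Q1 x y) (bigD1 (f x)) //= [X in _ = _ + X]big1 // addr0.
rewrite (bigD1 (g y)) //= big1 ?addr0 // => b' /negPf gb.
by rewrite Q0 // gb andbF.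
Qed.

Lemma card_deterministic_boxes : (0 < size A)%N -> (0 < size D)%N ->
  deterministic_boxes R A D #=
  `I_((\prod_(x : input A) nth 0 A x) * (\prod_(y : input D) nth 0 D y))%N.
Proof.
move=> A0 D0.
pose T := ({dffun forall x : 'I_(size A), 'I_(nth 0%N A x)} *
           {dffun forall y : 'I_(size D), 'I_(nth 0%N D y)})%type.
pose F (t : T) := det_box t.1 t.2.
have -> : deterministic_boxes R A D = F @` [set: T].
  apply/seteqP; split=> P.
    move=> /deterministic_boxesP[f [g ->]]; exists ([ffun x => f x], [ffun y => g y]) => //.
    by apply/ffunP => q; rewrite !ffunE.
  by move=> [t _ <-]; apply/deterministic_boxesP; exists t.1, t.2.
have Finj : injective F.
  move=> [f g] [f' g'] /ffunP E.
  have {}E x y : f' x = f x /\ g' y = g y.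
    have /eqP := E (@crd A x (f x), @crd D y (g y)); rewrite !ffunE /= !eqxx mulr1.
    case: (f x =P _) => [e1|_]; case: (g y =P _) => [e2|_];
      by rewrite ?(mul0r, mulr0) ?oner_eq0 // => _; split; exact: esym.
  (* Boxes only compare [f] and [g] at pairs of inputs, so each function is recovered with the help
     of input 0 of the other device. *)
  congr pair; apply/ffunP => x; first by have [] := E x (Ordinal D0).
  by have [] := E (Ordinal A0) x.
apply: (card_eq_trans (inj_card_eq (in2W Finj))).
rewrite -[X in `I_X](_ : #|{: T}| = _); first exact: card_setT_finType.
by rewrite card_prod !card_dep_ffun !foldrE !big_image /=;
   congr (_ * _)%N; apply: eq_bigr => i _; rewrite card_ord.
Qed.

End Deterministic.

(** * Inputs and outputs of the cardinality (2, 2) as booleans *)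

Notation bits := [:: 2; 2]%N.

Lemma ltn_bit (b : bool) : (b < 2)%N.
Proof. by case: b. Qed.

(** The bound [nth 0 bits x] does not reduce to 2 for a variable [x], hence a separate proof by
    cases on [x]. *)
Lemma ltn_bit_output (x : input bits) (a : bool) : (a < nth 0 bits x)%N.
Proof. by case: x a => [[|[]]] // ? []. Qed.

Definition bit_in (x : bool) : input bits := Ordinal (ltn_bit x).

Definition bit_out (x : input bits) (a : bool) : output x :=
  Ordinal (ltn_bit_output x a).

Lemma odd_bit_in x : odd (bit_in x) = x.
Proof. by case: x. Qed.

Lemma bit_in_odd (x : input bits) : bit_in (odd x) = x.
Proof. by apply: val_inj; case: x => [[|[]]]. Qed.

Lemma odd_bit_out x a : odd (@bit_out x a) = a.
Proof. by case: a. Qed.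

Lemma bit_out_odd (x : input bits) (a : output x) : bit_out x (odd a) = a.
Proof. by apply: val_inj; case: x a => [[|[]]] // ? [[|[]]]. Qed.

Lemma bit_out_inj x : injective (bit_out x).
Proof.
by move=> a b /(congr1 (fun i : output x => odd i)); rewrite !odd_bit_out.
Qed.

Lemma bit_in_ind (K : input bits -> Prop) :
  (forall x, K (bit_in x)) -> forall x, K x.
Proof. by move=> H x; rewrite -(bit_in_odd x). Qed.

Lemma bit_out_ind (x : input bits) (K : output x -> Prop) :
  (forall a, K (bit_out x a)) -> forall a, K a.
Proof. by move=> H a; rewrite -(bit_out_odd a). Qed.

Lemma sum_bit_out (V : nmodType) (x : input bits) (F : output x -> V) :
  \sum_(a : output x) F a = F (bit_out x false) + F (bit_out x true).
Proof.
rewrite (reindex (bit_out x)) ?big_bool 1?addrC //=.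
exists (fun a : output x => odd a) => a _; [exact: odd_bit_out|exact: bit_out_odd].
Qed.

(* [t = (alpha 0, alpha 1, x)] describes a local map at one input: it feeds [x]
   to the PR box, whose output is then [a = b (+) x y], and returns [alpha a]. *)
Definition lift_out (T : Type) (t : T * T * bool) (y b : bool) : T :=
  if b (+) (t.2 && y) then t.1.2 else t.1.1.

(** * Lifted boxes described by a triple at each input *)

Section Liftings.
Variables (R : realType) (C : cardinality).
Implicit Types P Q : box R C bits.

Definition prob P (z : input C) (c : output z) (y b : bool) : R :=
  P (crd c, crd (bit_out (bit_in y) b)).

Lemma prob_eqP P Q :
  (forall (z : input C) (c : output z) y b, prob P c y b = prob Q c y b) -> P = Q.
Proof.
move=> PQ; apply/ffunP => -[q1 q2]; rewrite (crdE q1) (crdE q2).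
move: (tag q2) (tagged q2); apply: bit_in_ind => y; apply: bit_out_ind => b.
exact: PQ.
Qed.

Lemma prob_sub_support P Q :
  (forall (z : input C) (c : output z) y b,
     prob P c y b = 0 -> prob Q c y b = 0) -> sub_support Q P.
Proof.
move=> PQ [q1 q2]; rewrite (crdE q1) (crdE q2).
move: (tag q2) (tagged q2); apply: bit_in_ind => y; apply: bit_out_ind => b.
exact: PQ.
Qed.

Lemma nonsignaling_probP P : nonsignaling R C bits P <->
  [/\ forall (z : input C) (c : output z) y b, 0 <= prob P c y b,
      forall (z : input C) y,
        \sum_(c : output z) (prob P c y false + prob P c y true) = 1,
      forall (z z' : input C) y b,
        \sum_(c : output z) prob P c y b = \sum_(c : output z') prob P c y b &
      forall (z : input C) (c : output z),
        prob P c false false + prob P c false true =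
        prob P c true false + prob P c true true].
Proof.
split=> [[P0 P1 PA PB]|[P0 P1 PA PB]]; split.
- by move=> z c y b; exact: P0.
- by move=> z y; rewrite -(P1 z (bit_in y)); apply: eq_bigr => c _; rewrite sum_bit_out.
- by move=> z z' y b; exact: PA.
- by move=> z c; have := PB (bit_in false) (bit_in true) z c; rewrite !sum_bit_out.
- move=> z + c; apply: bit_in_ind => y; apply: bit_out_ind => b; exact: P0.
- move=> z; apply: bit_in_ind => y; rewrite -(P1 z y).
  by apply: eq_bigr => c _; rewrite sum_bit_out.
- move=> z z'; apply: bit_in_ind => y; apply: bit_out_ind => b; exact: PA.
- move=> + + z c; apply: bit_in_ind => y; apply: bit_in_ind => y'.
  have E := PB z c; rewrite /prob in E; rewrite !sum_bit_out.
  by case: y; case: y'; rewrite ?E.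
Qed.

(** For either [y] the answer [b] is uniform and determines the output of the PR box on the other
    side, hence also [c]; this explains the single factor 1/2. *)
Definition lifted_box (s : forall z : input C, output z * output z * bool) :
    box R C bits :=
  [ffun q : coord_idx C * coord_idx bits => 2^-1 * (tagged q.1 ==
     lift_out (s (tag q.1)) (odd (tag q.2)) (odd (tagged q.2)))%:R].

(** Some input of the first device queries the PR box at [x] and keeps its two outputs apart.
    Required for both [x], this characterizes left invertibility. *)
Definition covers (s : forall z : input C, output z * output z * bool)
    (x : bool) :=
  exists z, (s z).1.1 != (s z).1.2 /\ (s z).2 = x.

Lemma prob_lifted_box s (z : input C) (c : output z) y b :
  prob (lifted_box s) c y b = 2^-1 * (c == lift_out (s z) y b)%:R.
Proof. by rewrite /prob ffunE /= !oddb. Qed.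

Lemma lifted_box_nonsignaling s : nonsignaling R C bits (lifted_box s).
Proof.
apply/nonsignaling_probP; split.
- by move=> z c y b; rewrite prob_lifted_box mulr_ge0 ?ler0n ?invr_ge0.
- move=> z y; under eq_bigr do rewrite !prob_lifted_box -mulrDr.
  by rewrite -mulr_sumr big_split /= !sum_eq_op mulVf // pnatr_eq0.
- move=> z z' y b; under eq_bigr do rewrite prob_lifted_box.
  under [RHS]eq_bigr do rewrite prob_lifted_box.
  by rewrite -!mulr_sumr !sum_eq_op.
- move=> z c; rewrite !prob_lifted_box /lift_out.
  by case: (s z) => [[c0 c1] []] //=; rewrite addrC.
Qed.

(** In a box [Q] with smaller support, [c] is a function of [y] and [b], so [Q] is determined by the
    marginals of the second device. The covering inputs impose enough equations to make these
    uniform. *)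
Lemma lifted_box_extreme s : covers s false -> covers s true ->
  extreme_points (nonsignaling R C bits) (lifted_box s).
Proof.
move=> [z0 [nc0 x0]] [z1 [nc1 x1]]; apply: sub_support_extreme.
  exact: lifted_box_nonsignaling.
move=> Q /nonsignaling_probP[Q0 Q1 QA QB] Qs.
have Qz (z : input C) (c : output z) y b :
    c != lift_out (s z) y b -> prob Q c y b = 0.
  move=> /negPf nc; apply: Qs; rewrite -/(prob (lifted_box s) c y b).
  by rewrite prob_lifted_box nc mulr0.
pose m z y b := prob Q (lift_out (s z) y b) y b.
have mE z y b : \sum_(c : output z) prob Q c y b = m z y b.
  by rewrite (bigD1 (lift_out (s z) y b)) //= big1 ?addr0 // => c /Qz.
have mz z z' y b : m z y b = m z' y b by rewrite -!mE; exact: QA.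
have m1 z y : m z y false + m z y true = 1.
  by rewrite -(Q1 z y) big_split /= !mE.
(* At [z0] the output [alpha 0] occurs only with [b = 0], for both [y]; equality of its marginals
   compares two masses. At [z1] it occurs with [b = y] instead. *)
have e0 : m z0 false false = m z0 true false.
  have := QB _ (s z0).1.1; rewrite /m /lift_out x0 /=.
  by rewrite ![prob _ _ _ true]Qz /lift_out ?x0 ?addr0.
have e1 : m z1 false false = m z1 true true.
  have := QB _ (s z1).1.1; rewrite /m /lift_out x1 /=.
  rewrite [prob _ _ false true]Qz ?[prob _ _ true false]Qz /lift_out ?x1 //.
  by rewrite addr0 add0r.
have mh z y b : m z y b = 2^-1.
  rewrite (mz z z0); have := (m1 z0 false, m1 z0 true); move: e1.
  rewrite !(mz z1 z0) => e1' [h0 h1].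
  by case: y; case: b; lra.
apply: prob_eqP => z c y b; rewrite prob_lifted_box.
by have [->|/Qz->] := eqVneq c; rewrite ?mulr1 ?mulr0 // -/(m z y b) mh.
Qed.

End Liftings.

(** * Deterministic or lifted supports inside an arbitrary nonsignaling box *)

Section Existence.
Variables (R : realType) (C : cardinality) (P : box R C bits).
Hypothesis NP : nonsignaling R C bits P.

(* [(b, b')] is a pair of answers of the second device to the inputs [y] and
   [~~ y]; compatibility at [z] means that the first device has an answer to
   [z] that can occur together with each of them. *)
Definition compatible (z : input C) (y b b' : bool) :=
  [exists c : output z, (0 < prob P c y b) && (0 < prob P c (~~ y) b')].

Lemma compatibleC z y b b' : compatible z y b b' = compatible z (~~ y) b' b.
Proof. by apply: eq_existsb => c; rewrite negbK andbC. Qed.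

Lemma sum_prob_gt0 (z : input C) y b :
  (0 < \sum_(c : output z) prob P c y b) = [exists c : output z, 0 < prob P c y b].
Proof.
have [P0 _ _ _] := (nonsignaling_probP P).1 NP.
rewrite lt0r sumr_ge0 // andbT psumr_neq0 //.
by apply/hasP/existsP => [[c _ Pc]|[c Pc]]; exists c; rewrite ?mem_index_enum.
Qed.

(** The marginal probability of [c] is the same for both inputs of the second device. *)
Lemma prob_flip (z : input C) (c : output z) y b :
  0 < prob P c y b -> exists b', 0 < prob P c (~~ y) b'.
Proof.
have [P0 _ _ PB] := (nonsignaling_probP P).1 NP => Pb.
have : 0 < prob P c (~~ y) false + prob P c (~~ y) true.
  have -> : prob P c (~~ y) false + prob P c (~~ y) true =
            prob P c y b + prob P c y (~~ b).
    by have := PB z c; case: y {Pb}; case: b => /=; lra.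
  exact: ltr_pwDl.
have := P0 z c (~~ y) false; have := P0 z c (~~ y) true.
rewrite !le0r => /orP[/eqP-> /orP[/eqP->|]|]; first by rewrite addr0 ltxx.
- by exists false.
- by exists true.
Qed.

Lemma det_box_sub_support b b' : (forall z, compatible z false b b') ->
  exists f g, sub_support (det_box R f g) P.
Proof.
move=> bb'; exists (fun z => xchoose (existsP (bb' z))).
exists (fun y => bit_out y (if odd y then b' else b)).
apply: prob_sub_support => z c y d; rewrite {2}/prob ffunE /= oddb.
case: eqP => [->|_]; last by rewrite mul0r.
case: eqP => [/(@bit_out_inj (bit_in y))->|_]; last by rewrite mulr0.
have /andP[] := xchooseP (existsP (bb' z)); set c0 := xchoose _; move=> h h'.
by case: y => /= P0; [move: h'|move: h]; rewrite P0 ltxx.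
Qed.

Hypothesis incompatible : forall b b', exists z, ~~ compatible z false b b'.

Lemma incompatible_input y b b' : exists z, ~~ compatible z y b b'.
Proof.
by case: y; [have [z] := incompatible b' b; rewrite compatibleC|
             have [z] := incompatible b b']; exists z.
Qed.

(* If the answer [b] to [y] were impossible, then [~~ b] together with any
   possible answer to [~~ y] would be compatible at all inputs. *)
Lemma prob_gt0 (z : input C) y b : exists c : output z, 0 < prob P c y b.
Proof.
have [P0 P1 PA PB] := (nonsignaling_probP P).1 NP.
apply/existsP; rewrite -sum_prob_gt0; apply: contraT => nPyb.
have Pb0 (z' : input C) (c : output z') : ~~ (0 < prob P c y b).
  move: nPyb; rewrite (PA z z') sum_prob_gt0 negb_exists => /forallP; exact.
have [b' Pb'] : exists b', 0 < \sum_(c : output z) prob P c (~~ y) b'.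
  have := P1 z (~~ y); rewrite big_split /=.
  case: (ltP 0 (\sum_(c : output z) prob P c (~~ y) false)); first by exists false.
  move=> le0 e1; exists true; lra.
have [z' /negP[]] := incompatible_input y (~~ b) b'.
move: Pb'; rewrite (PA z z') sum_prob_gt0 => /existsP[c Pc].
apply/existsP; exists c; rewrite Pc andbT.
have [d] := prob_flip Pc; rewrite negbK; have := Pb0 z' c.
by case: b {Pb0 nPyb} => /negPf nP; case: d => //=; rewrite nP.
Qed.

Lemma compatible_gt0 z y b : exists b', compatible z y b b'.
Proof.
have [c Pc] := prob_gt0 z y b; have [b' Pb'] := prob_flip Pc.
by exists b'; apply/existsP; exists c; rewrite Pc.
Qed.

(** Take for [alpha 0] and [alpha 1] the common answers witnessing the pairs [(0, x)] and
    [(1, ~~ x)]. If they coincided, this answer would make [(0, ~~ x)] compatible. *)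
Lemma local_lift x z : (forall b, compatible z false b (b (+) x)) ->
  exists t : output z * output z * bool,
    [/\ forall y b, 0 < prob P (lift_out t y b) y b, t.2 = x &
        ~~ compatible z false false (~~ x) -> t.1.1 != t.1.2].
Proof.
move=> cx; have [/existsP[c0 /andP[h00 h01]] /existsP[c1 /andP[h10 h11]]] :=
  (cx false, cx true).
exists (c0, c1, x); split=> //=.
  by move=> y b; move: h00 h01 h10 h11; rewrite /lift_out; case: x {cx}; case: y; case: b.
apply: contraNneq => e; apply/existsP; exists c0; rewrite h00 /=.
by rewrite e; case: x {cx h01} h11.
Qed.

Lemma lifted_box_sub_support :
  exists s, [/\ covers s false, covers s true & sub_support (lifted_box R s) P].
Proof.
(* The second clause makes the choice of [x] forced wherever [(0, 0)] or [(0, 1)] is incompatible;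
   such inputs later supply the two coverings. *)
have lift z : exists t : output z * output z * bool,
    (forall y b, 0 < prob P (lift_out t y b) y b) /\
    forall x, ~~ compatible z false false (~~ x) -> t.1.1 != t.1.2 /\ t.2 = x.
  have l x : (forall b, compatible z false b (b (+) x)) ->
      (~~ compatible z false false x -> False) ->
      exists t : output z * output z * bool,
    (forall y b, 0 < prob P (lift_out t y b) y b) /\
    forall x, ~~ compatible z false false (~~ x) -> t.1.1 != t.1.2 /\ t.2 = x.
    move=> /local_lift[t [t1 t2 t3]] nx; exists t; split=> // x' nx'.
    have [ex|nxx'] := eqVneq x' x; first by rewrite ex in nx' *; rewrite t3.
    by case: nx; move: nx' nxx'; case: x' => //; case: x {t2 t3}.
  have cr b : exists b', compatible z false b' b.
    by have [b'] := compatible_gt0 z true b; rewrite compatibleC; exists b'.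
  have cl := compatible_gt0 z false.
  (* Compatibility is a bipartite graph on 2 + 2 vertices without isolated vertices, so it contains
     a perfect matching: the diagonal ([x = 0]) or the antidiagonal ([x = 1]). *)
  case c00 : (compatible z false false false); last first.
    apply: (l true) => [[]|]; rewrite /=.
    - by have [[]] := cr false; rewrite ?c00.
    - by have [[]] := cl false; rewrite ?c00.
    - by have [[]] := cl false; rewrite ?c00 // => ->.
  case c11 : (compatible z false true true).
    by apply: (l false) => [[]|]; rewrite /= ?c00.
  have c01 : compatible z false false true.
    by have [[]] := cr true; rewrite ?c11.
  apply: (l true) => [[]|]; rewrite /= ?c01 //.
  by have [[]] := cl true; rewrite ?c11.
exists (fun z => sval (cid (lift z))); split.
- have [z nz] := incompatible false true; exists z.
  by apply: (svalP (cid (lift z))).2.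
- have [z nz] := incompatible false false; exists z.
  by apply: (svalP (cid (lift z))).2.
apply: prob_sub_support => z c y b Pc; rewrite prob_lifted_box.
case: eqP => [ec|_]; last by rewrite mulr0.
by have := (svalP (cid (lift z))).1 y b; rewrite -ec Pc ltxx.
Qed.

End Existence.

Lemma extreme_points_nonsignalingP (R : realType) (C : cardinality)
    (P : box R C bits) : extreme_points (nonsignaling R C bits) P <->
  (exists f g, P = det_box R f g) \/
  (exists s, [/\ covers s false, covers s true & P = lifted_box R s]).
Proof.
split=> [eP|[[f [g ->]]|[s [s0 s1 ->]]]]; last 2 first.
- exact: det_box_extreme.
- exact: lifted_box_extreme.
have NP := eP.1.
have [|ninc] := pselect (exists b b', forall z, compatible P z false b b').
  move=> [b [b' /det_box_sub_support[f [g fg]]]]; left; exists f, g.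
  by rewrite (extreme_sub_support eP _ fg) //; exact: det_box_nonsignaling.
have inc b b' : exists z, ~~ compatible P z false b b'.
  apply: contra_notP ninc => nz; exists b, b' => z.
  by apply: contra_notT nz => ?; exists z.
have [s [s0 s1 sP]] := lifted_box_sub_support NP inc.
right; exists s; split=> //.
by rewrite (extreme_sub_support eP _ sP) //; exact: lifted_box_nonsignaling.
Qed.

(** * Matrices of local maps and left invertibility *)

(** Trades the existential in the matrix entry for a sum over outputs: a column is hit by at most
    one [a], since [crd] is injective. *)
Lemma sum_map_matrix (R : realType) (A C : cardinality) (L : local_map A C)
    (q : coord_idx C) (F : coord_idx A -> R) :
  \sum_p map_matrix R L q p * F p =
  \sum_(a : output (xi L (tag q))) (tagged q == alpha a)%:R * F (crd a).
Proof.
transitivity (\sum_p \sum_(a : output (xi L (tag q)))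
    (tagged q == alpha a)%:R * ((p == crd a)%:R * F p)).
  apply: eq_bigr => p _; rewrite /map_matrix.
  case: existsP => [[a /andP[/eqP pa qa]]|np]; last first.
    rewrite mul0r big1 // => a _.
    case: eqP => [qa|]; rewrite ?mul0r //; case: eqP => [pa|]; rewrite ?mul0r ?mulr0 //.
    by case: np; exists a; rewrite -pa -qa !eqxx.
  rewrite (bigD1 a) //= qa pa eqxx !mul1r big1 ?addr0 // => a' /negPf aa'.
  have [/crd_inj e|_] := eqVneq (crd a) (crd a'); last by rewrite mul0r mulr0.
  by rewrite e eqxx in aa'.
rewrite exchange_big; apply: eq_bigr => a _.
rewrite -mulr_sumr (bigD1 (crd a)) //= eqxx mul1r big1 ?addr0 //.
by move=> p /negPf->; rewrite mul0r.
Qed.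

Lemma mulmv_map_matrix (R : realType) (A C : cardinality) (L : local_map A C)
    (v : dev_space R A) (z : input C) (c : output z) :
  mulmv (map_matrix R L) v (crd c) =
  \sum_(a : output (xi L z)) (c == alpha a)%:R * v (crd a).
Proof. by rewrite ffunE sum_map_matrix. Qed.

Section LocalMaps.
Variable C : cardinality.

Definition map_strategy (L : local_map bits C) (z : input C) :
    output z * output z * bool :=
  (alpha (bit_out (xi L z) false), alpha (bit_out (xi L z) true), odd (xi L z)).

Lemma lift_mapE (R : realType) (L : local_map bits C) :
  mulmv (kron (map_matrix R L) (@idmat R (coord_idx bits))) (PR_box R) =
  lifted_box R (map_strategy L).
Proof.
apply: prob_eqP => z c y b; rewrite prob_lifted_box /prob ffunE.
transitivity (\sum_p \sum_q kron (map_matrix R L) (@idmat R (coord_idx bits))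
    (crd c, crd (bit_out (bit_in y) b)) (p, q) * PR_box R (p, q)).
  by rewrite pair_bigA; apply: eq_bigr => -[].
transitivity (\sum_p map_matrix R L (crd c) p *
    PR_box R (p, crd (bit_out (bit_in y) b))).
  apply: eq_bigr => p _; rewrite (bigD1 (crd (bit_out (bit_in y) b))) //=.
  rewrite /kron /idmat /= eqxx mulr1 big1 ?addr0 // => q /negPf nq.
  by rewrite eq_sym nq mulr0 mul0r.
rewrite sum_map_matrix /= sum_bit_out !ffunE /= /map_strategy /lift_out /=.
(* The type of [alpha] depends on [xi L z], so it is generalized before [xi L z] is rewritten as a
   bit. *)
move: (@alpha _ _ L z); rewrite -(bit_in_odd (xi L z)) => al.
by rewrite odd_bit_in; case: (odd _) al => al; case: y; case: b;
   rewrite /= ?mulr0 ?addr0 ?add0r mulrC.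
Qed.

(** A left inverse recovers the output at [x] from a single input [z], so [z] must query [x] and
    [alpha] must be injective there. Conversely, querying the covering inputs and decoding their
    answers gives a left inverse. *)
Lemma left_invertibleP (R : realType) (L : local_map bits C) :
  left_invertible R L <->
  covers (map_strategy L) false /\ covers (map_strategy L) true.
Proof.
split.
  move=> [L' LK].
  suff cov x : covers (map_strategy L) x by [].
  pose z := xi L' (bit_in x); exists z.
  have inv a : xi L z = bit_in x /\
      bit_out (bit_in x) a = alpha (alpha (bit_out (xi L z) a)).
    have [a' /andP[/eqP aa' /eqP ->]] : exists a' : output (xi L z),
        (crd a' == crd (bit_out (bit_in x) a)) &&
        (bit_out (bit_in x) a == alpha (alpha a')).
      apply/existsP; apply: contraT; rewrite negb_exists => /forallP na.
      (* If no [a'] at [z] is carried back to [(a, x)], the unit vector at that coordinate is sent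
         to a vector vanishing there. *)
      pose v : dev_space R bits := [ffun q => (q == crd (bit_out (bit_in x) a))%:R].
      have /ffunP/(_ (crd (bit_out (bit_in x) a)))/eqP := LK v.
      rewrite mulmv_map_matrix ffunE eqxx big1 ?(eq_sym 0) ?oner_eq0 // => c _.
      have [ec|_] := eqVneq (bit_out (bit_in x) a) (alpha c); last by rewrite mul0r.
      rewrite mulmv_map_matrix big1 ?mulr0 // => a' _; rewrite ffunE.
      have [ec'|_] := eqVneq c (alpha a'); last by rewrite mul0r.
      by move: (na a'); rewrite -ec' -ec eqxx andbT => /negPf->; rewrite mulr0.
    split; first exact: (congr1 (fun q => tag q) aa').
    have /= := congr1 (fun q : coord_idx bits => odd (tagged q)) aa'.
    by rewrite oddb => <-; rewrite bit_out_odd.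
  have [xz b0] := inv false; have [_ b1] := inv true.
  split; last by rewrite /= xz odd_bit_in.
  apply/eqP => /= e; move: b0; rewrite e -b1.
  by move=> /bit_out_inj.
move=> [[z0 [n0 x0]] [z1 [n1 x1]]].
pose z (x : bool) := if x then z1 else z0.
have nz x : (map_strategy L (z x)).1.1 != (map_strategy L (z x)).1.2 by case: x.
have xz (x : input bits) : xi L (z (odd x)) = x.
  rewrite -[RHS]bit_in_odd -[LHS]bit_in_odd; congr bit_in.
  by case: (odd x); [exact: x1|exact: x0].
(* Decoding returns 1 exactly on the image of 1; every other answer, in particular the image of 0,
   gives 0. *)
pose L' : local_map C bits := @LocalMap C bits (fun x => z (odd x))
  (fun x c => bit_out x (c == (map_strategy L (z (odd x))).1.2)).
exists L' => v; apply/ffunP => q; rewrite (crdE q).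
move: (tag q) (tagged q) => x; apply: bit_out_ind => a.
rewrite mulmv_map_matrix; under eq_bigr do rewrite mulmv_map_matrix mulr_sumr.
rewrite exchange_big /=.
under eq_bigr => a' _.
  under eq_bigr do rewrite mulrCA.
  rewrite sum_eq_op_mul; over.
rewrite sum_bit_out /= eqxx (negPf (nz (odd x))).
rewrite !(inj_eq (@bit_out_inj x)).
have E b : crd (bit_out (xi L (z (odd x))) b) = crd (bit_out x b) by exact: eq_crd.
by rewrite !E; case: a; rewrite /= ?mul1r ?mul0r ?add0r ?addr0.
Qed.

Definition strategy_map (s : forall z : input C, output z * output z * bool) :
    local_map bits C :=
  @LocalMap bits C (fun z => bit_in (s z).2)
    (fun z a => if odd a then (s z).1.2 else (s z).1.1).

Lemma strategy_mapK s z : map_strategy (strategy_map s) z = s z.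
Proof. by rewrite /map_strategy /= odd_bit_in; case: (s z) => [[]]. Qed.

Lemma PR_liftingsP (R : realType) (P : box R C bits) : PR_liftings R C P <->
  exists s, [/\ covers s false, covers s true & P = lifted_box R s].
Proof.
split=> [[L /left_invertibleP[s0 s1] <-]|[s [s0 s1 ->]]].
  by exists (map_strategy L); split=> //; exact: lift_mapE.
exists (strategy_map s).
  apply/left_invertibleP; move: s0 s1 => [z0 h0] [z1 h1].
  by split; [exists z0|exists z1]; rewrite strategy_mapK.
by rewrite lift_mapE; apply/ffunP => q; rewrite !ffunE strategy_mapK.
Qed.

End LocalMaps.

(** * Counting the triples at one input *)

Section CountStrategies.
Variable T : finType.
Implicit Types (t : T * T * bool) (x : bool).

(* The input [t.2] of the PR box is irrelevant when both outputs are mapped to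
   the same one; it is then normalized to [false]. *)
Definition normal t := t.2 ==> (t.1.1 != t.1.2).

Definition normalize t := (t.1, t.2 && (t.1.1 != t.1.2)).

(** Among normal triples, those that do not query [x] with distinct outputs. The equation determines
    [t.2] from the two outputs, so the count is immediate. *)
Definition avoids x t := t.2 == (t.1.1 != t.1.2) && ~~ x.

Lemma normal_normalize t : normal (normalize t).
Proof. by rewrite /normal /normalize /=; case: (t.2); case: (_ == _). Qed.

Lemma lift_out_normalize t : lift_out (normalize t) =2 lift_out t.
Proof.
move=> y b; rewrite /lift_out /=; case: (t.2) => //=.
by case: eqP => // ->; case: (b (+) _); case: (b (+) _).
Qed.

(** The values at [y = 0] reveal the two outputs; a value at [y = 1] reveals [t.2] when they differ,
    and normality fixes it when they agree. *)
Lemma lift_out_inj t t' : normal t -> normal t' ->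
  lift_out t =2 lift_out t' -> t = t'.
Proof.
case: t t' => [[c0 c1] x] [[d0 d1] x'] /= nt nt' E.
have := E false false; have := E false true; have := E true false.
rewrite /lift_out /= !andbF !andbT /= => + e1 e0; subst d0 d1.
move: nt nt'; rewrite /normal.
by case: x {E}; case: x' => //= + + e; rewrite e eqxx.
Qed.

Lemma avoids_normal x t : avoids x t -> normal t.
Proof. by rewrite /avoids /normal => /eqP->; case: (_ == _); case: x. Qed.

Lemma avoidsPn x t : normal t ->
  reflect (t.1.1 != t.1.2 /\ t.2 = x) (~~ avoids x t).
Proof.
rewrite /normal /avoids; case: (t.1.1 == _); case: (t.2); case: x => //= _;
  by constructor => // -[].
Qed.

Lemma card_avoids x : #|avoids x| = (#|T| ^ 2)%N.
Proof.
pose F (p : T * T) := (p, (p.1 != p.2) && ~~ x).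
have Finj : injective F by move=> p q [].
rewrite -mulnn -card_prod -(card_codom Finj); apply: eq_card => -[p b].
apply/eqP/codomP => /= [->|[p' [-> ->]] //]; by exists p.
Qed.

Lemma card_avoidsI : #|predI (avoids false) (avoids true)| = #|T|.
Proof.
pose F (c : T) := (c, c, false).
have Finj : injective F by move=> p q [].
rewrite -(card_codom Finj); apply: eq_card => -[[c d] b].
rewrite -[LHS]/(avoids false _ && avoids true _) /avoids /= andbT andbF.
apply/andP/codomP => [[/eqP-> /eqP/negbFE/eqP<-]|[c' [-> -> ->]]].
  by exists c; rewrite /F eqxx.
by rewrite eqxx.
Qed.

(** A triple queries only one input of the PR box, so every normal triple avoids 0 or 1;
    inclusion-exclusion then applies. *)
Lemma card_normal : #|normal| = (2 * #|T| ^ 2 - #|T|)%N.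
Proof.
have := cardUI (avoids false) (avoids true).
rewrite card_avoidsI !card_avoids addnn -mul2n => <-; rewrite addnK.
apply: eq_card => t; rewrite -[LHS]/(normal _) -[RHS]/(avoids false _ || avoids true _).
rewrite /normal /avoids andbT andbF.
by case: (t.2); case: (_ == _).
Qed.

End CountStrategies.

(** * Counting the liftings *)

Section CountLiftings.
Variables (R : realType) (C : cardinality).

Definition strategy :=
  {dffun forall z : 'I_(size C), 'I_(nth 0%N C z) * 'I_(nth 0%N C z) * bool}.

Definition normal_strategies :=
  family (fun z : 'I_(size C) => @normal 'I_(nth 0%N C z)) : simpl_pred strategy.

Definition avoiding x :=
  family (fun z : 'I_(size C) => @avoids 'I_(nth 0%N C z) x) : simpl_pred strategy.

Definition separating :=
  predD normal_strategies (predU (avoiding false) (avoiding true)).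

Lemma coversPn (s : strategy) x : s \in normal_strategies ->
  covers s x <-> s \notin avoiding x.
Proof.
move=> /familyP ns; split=> [[z sz]|].
  by apply/negP => /familyP/(_ z); apply/negP; apply/avoidsPn => //; exact: ns.
rewrite inE negb_forall => /existsP[z nz]; exists z.
by apply/avoidsPn => //; exact: ns.
Qed.

(** Inclusion-exclusion over the two values of [x]: each family is a product over the inputs, and so
    is their intersection. *)
Lemma card_separating : #|separating| =
  (\prod_(z < size C) (2 * nth 0 C z ^ 2 - nth 0 C z) -
   (2 * \prod_(z < size C) nth 0 C z ^ 2 - \prod_(z < size C) nth 0 C z))%N.
Proof.
have prodE (F : forall z : 'I_(size C),
    pred ('I_(nth 0%N C z) * 'I_(nth 0%N C z) * bool)) :
    #|(family F : simpl_pred strategy)| = (\prod_z #|F z|)%N.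
  by rewrite card_family foldrE big_image.
have cI : #|predI (avoiding false) (avoiding true)| = (\prod_(z < size C) nth 0 C z)%N.
  transitivity (\prod_(z < size C)
      #|predI (@avoids 'I_(nth 0%N C z) false) (@avoids _ true)|)%N; last first.
    by apply: eq_bigr => z _; rewrite card_avoidsI card_ord.
  rewrite -(prodE (fun z => predI (@avoids 'I_(nth 0%N C z) false) (@avoids _ true))).
  apply: eq_card => s; rewrite !inE.
  apply/andP/forallP => [[/forallP h0 /forallP h1] z|h].
    by rewrite inE; apply/andP; split; [exact: h0|exact: h1].
  by split; apply/forallP => z; case/andP: (h z).
have cU : #|predU (avoiding false) (avoiding true)| =
    (2 * \prod_(z < size C) nth 0 C z ^ 2 - \prod_(z < size C) nth 0 C z)%N.
  rewrite -cI; have := cardUI (avoiding false) (avoiding true).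
  rewrite /avoiding !prodE.
  under eq_bigr do rewrite card_avoids card_ord.
  under [X in _ = (_ + X)%N -> _]eq_bigr do rewrite card_avoids card_ord.
  by rewrite addnn -mul2n => <-; rewrite addnK.
have := cardID (predU (avoiding false) (avoiding true)) normal_strategies.
(* Avoiding strategies are already normal, so intersecting with the normal ones changes nothing. *)
rewrite [X in (X + _)%N](_ : _ = #|predU (avoiding false) (avoiding true)|).
  rewrite cU prodE.
  under eq_bigr do rewrite card_normal card_ord.
  by move=> <-; rewrite addKn.
apply: eq_card => s; rewrite !inE andb_idl //.
by case/orP => /forallP H; apply/forallP => z; apply: avoids_normal (H z).
Qed.

(** Normalized covering strategies parametrize the liftings bijectively: the support of a lifted box
    determines [lift_out], hence the normal triple at each input. *)
Lemma card_PR_liftings : PR_liftings R C #=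
  `I_(\prod_(z < size C) (2 * nth 0 C z ^ 2 - nth 0 C z) -
   (2 * \prod_(z < size C) nth 0 C z ^ 2 - \prod_(z < size C) nth 0 C z))%N.
Proof.
rewrite -card_separating -cardsE.
pose X := finset separating.
have XP (s : strategy) : s \in X <->
    [/\ s \in normal_strategies, covers s false & covers s true].
  rewrite inE; split=> [/andP[/norP[n0 n1] ns]|[ns /coversPn n0 /coversPn n1]].
    by split=> //; apply/coversPn.
  by apply/andP; split => //; apply/norP; split; [exact: n0|exact: n1].
have -> : PR_liftings R C = (fun s : strategy => lifted_box R s) @` [set` X].
  apply/seteqP; split=> P.
    move=> /PR_liftingsP[s [s0 s1 ->]].
    exists [ffun z => normalize (s z)].
      apply/XP; split.
      - by apply/familyP => z; rewrite ffunE; exact: normal_normalize.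
      - by move: s0 => [z [nz sz]]; exists z; rewrite ffunE /= nz andbT.
      - by move: s1 => [z [nz sz]]; exists z; rewrite ffunE /= nz andbT.
    by apply/ffunP => q; rewrite !ffunE lift_out_normalize.
  by move=> [s /XP[_ s0 s1] <-]; apply/PR_liftingsP; exists s.
apply: (card_eq_trans _ (card_set_finType X)).
apply: inj_card_eq => s s' /set_mem/XP[/familyP ns _ _] /set_mem/XP[/familyP ns' _ _] E.
apply/ffunP => z; apply: lift_out_inj => [||y b]; [exact: ns|exact: ns'|].
(* The entry at the output prescribed by [s] is 1/2 in the common box, so [s'] must prescribe the
   same output. *)
have := prob_lifted_box R s' (lift_out (s z) y b) y b.
rewrite -E prob_lifted_box eqxx; case: eqP => // _ /eqP.
by rewrite mulr1 mulr0 invr_eq0 pnatr_eq0.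
Qed.

(** The covering condition supplies an input, where the lifted box has an entry 1/2; deterministic
    entries are 0 or 1. *)
Lemma det_box_neq_lifted_box f g s x : covers s x ->
  det_box R f g <> lifted_box R s :> box R C bits.
Proof.
have h01 (b : bool) : b%:R <> 2^-1 :> R by case: b => /= h; lra.
move=> [z _] E.
have := prob_lifted_box R s (lift_out (s z) false false) false false.
rewrite -E /prob ffunE /= eqxx mulr1 -natrM mulnb.
exact: h01.
Qed.

End CountLiftings.

Theorem mainTheorem16 (R : realType) :
  let C := [:: 3; 3; 3]%N in
  let D := [:: 2; 2]%N in
  [/\ PR_liftings R C #= `I_1944,
      PR_liftings R C `<=` extreme_points (nonsignaling R C D),
      deterministic_boxes R C D #= `I_(3 ^ 3 * 2 ^ 2)%N,
      extreme_points (nonsignaling R C D)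
        = deterministic_boxes R C D `|` PR_liftings R C &
      extreme_points (nonsignaling R C D) #= `I_2052].
Proof.
move=> C D.
have cL : PR_liftings R C #= `I_1944.
  (* With three outputs at three inputs the count is [15^3 - (2 * 9^3 - 3^3) = 1944]. *)
  by have := card_PR_liftings R C; rewrite /C !big_ord_recl !big_ord0.
have cD : deterministic_boxes R C D #= `I_(3 ^ 3 * 2 ^ 2)%N.
  have := @card_deterministic_boxes R C D isT isT.
  by rewrite /C /D !big_ord_recl !big_ord0.
have eE : extreme_points (nonsignaling R C D) =
    deterministic_boxes R C D `|` PR_liftings R C.
  apply/seteqP; split=> P; rewrite /setU /=.
    move=> /extreme_points_nonsignalingP[?|?]; [left|right].
      exact/deterministic_boxesP.
    exact/PR_liftingsP.
  by move=> [/deterministic_boxesP ?|/PR_liftingsP ?];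
    apply/extreme_points_nonsignalingP; [left|right].
split=> //; first by rewrite eE; exact: subsetUr.
(* The two kinds of vertices are disjoint, and [108 + 1944 = 2052]. *)
rewrite eE; apply: (@card_setU_disjoint _ _ _ (3 ^ 3 * 2 ^ 2) 1944 cD cL).
apply/seteqP; split=> // P [/deterministic_boxesP[f [g ->]]].
by move=> /PR_liftingsP[s [s0 _ /(det_box_neq_lifted_box s0)]].
Qed.
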